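(* Let $V$ be a finite-dimensional diffeological vector space, let $\langle\cdot|\cdot\rangle_A$ be a pseudo-metric on $V$, and let $V^*$ be the diffeological dual of $V$ with the functional diffeology. Then $\langle\cdot|\cdot\rangle_A$ induces a true metric on $V^*$ via the natural pairing $\Psi:V\to V^*$, $\Psi(v)=\langle\cdot|v\rangle_A$; that is, setting $$\langle f,g\rangle:=\langle v|w\rangle_A\quad\text{for any } v\in\Psi^{-1}(f),\ w\in\Psi^{-1}(g)\qquad(f,g\in V^* )$$ gives a well-defined smooth scalar product on $V^*$.
   Context: A diffeology on a set $X$ is a collection of maps $U\to X$ (plots), $U$ ranging over open subsets of $\mathbb{R}^m$, $m\in\mathbb{N}$, such that: all constant maps are plots; if $p:U\to X$ is a plot and $h:U'\to U$ is an ordinary smooth map from an open set $U'$ of a Euclidean space, then $p\circ h$ is a plot; a map $U\to X$ that restricts to a plot on each member of an open cover of $U$ is a plot. A map between diffeological spaces is smooth if its composition with each plot of the source is a plot of the target. The product $X_1\times X_2$ has the product diffeology: a map $U\to X_1\times X_2$ is a plot iff both of its components are plots. The standard diffeology on $\mathbb{R}^k$ consists of all ordinary smooth maps into $\mathbb{R}^k$. A diffeological vector space is a real vector space $V$ with a diffeology for which addition $V\times V\to V$ and scalar multiplication $\mathbb{R}\times V\to V$ are smooth ($\mathbb{R}$ standard). The diffeological dual $V^*$ is the vector space of all smooth linear functionals $V\to\mathbb{R}$ ($\mathbb{R}$ standard), endowed with the functional diffeology: a map $q:U\to V^*$ is a plot iff for every plot $p:U'\to V$ of $V$ the map $U\times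 U'\to\mathbb{R}$, $(u,u')\mapsto q(u)(p(u'))$, is smooth in the usual sense. A pseudo-metric on an $n$-dimensional diffeological vector space $V$ (identified as a vector space with $\mathbb{R}^n$) is a symmetric bilinear form $\langle v|w\rangle_A=v^tAw$ on $V$, smooth as a map $V\times V\to\mathbb{R}$ for the product diffeology on $V\times V$ and the standard diffeology on $\mathbb{R}$, such that the eigenvalue $0$ of the symmetric matrix $A$ has multiplicity $n-\dim(V^* )$ and all the other eigenvalues are positive. A smooth scalar product (true metric) on a diffeological vector space $W$ is a symmetric positive definite bilinear form $W\times W\to\mathbb{R}$ that is smooth for the product diffeology on $W\times W$ and the standard diffeology on $\mathbb{R}$. *)

(* Defs.v *)
From HB Require Import structures.
From mathcomp Require Import all_boot all_order all_algebra.
From mathcomp Require Import all_classical all_reals all_analysis.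
Set Implicit Arguments.
Unset Strict Implicit.
Unset Printing Implicit Defensive.
Import Order.TTheory GRing.Theory Num.Theory.
Import numFieldNormedType.Exports.
Local Open Scope classical_set_scope.
Local Open Scope ring_scope.

Section Smooth.
Variable R : realType.

(* C^k on an open set [U]: for [k > 0], Frechet differentiable on [U] with all
   directional derivatives C^(k-1). The values of [f] outside of [U] are
   irrelevant when [U] is open. *)
Fixpoint Ck (m : nat) (W : normedModType R) (k : nat) (U : set 'rV[R]_m)
    (f : 'rV[R]_m -> W) : Prop :=
  match k with
  | 0 => forall x, U x -> {for x, continuous f}
  | k'.+1 => (forall x, U x -> differentiable f x) /\
             (forall v, Ck k' U ('D_v f))
  end.

Definition smooth_on (m : nat) (W : normedModType R) (U : set 'rV[R]_m)
  (f : 'rV[R]_m -> W) : Prop := forall k, Ck k U f.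

Lemma near_eq_differentiable (V W : normedModType R) (f g : V -> W) x :
  (\near x, f x = g x) -> differentiable f x -> differentiable g x.
Proof.
move=> fg df.
have [dfc /eqaddoP dfE] := (diff_locallyP x f).1 df.
suff gE : g \o shift x = cst (g x) + 'd f x +o_ (0 : V) id.
  have dgE := diff_unique dfc gE.
  by apply/diff_locallyP; split; rewrite dgE.
apply/eqaddoP => e e0.
have fg0 : \forall h \near (0 : V), f (h + x) = g (h + x).
  by move: fg; rewrite (near_shift 0 x (fun y => f y = g y)) subr0.
apply: filterS2 fg0 (dfE e e0) => h fgh.
by rewrite !fctE /= fgh (nbhs_singleton fg).
Qed.

Lemma Ck_eq m (W : normedModType R) k (U : set 'rV[R]_m) (f g : 'rV[R]_m -> W) :
  open U -> (forall x, U x -> f x = g x) -> Ck k U f -> Ck k U g.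
Proof.
move=> oU fg.
have near_eq (f' g' : 'rV[R]_m -> W) x : (forall y, U y -> f' y = g' y) ->
    U x -> \near x, f' x = g' x.
  by move=> fg' Ux; near=> y; apply: fg'; near: y; exact: open_nbhs_nbhs.
elim: k f g fg => [|k IH] f g fg.
  move=> fC x Ux; rewrite /prop_for /continuous_at -(fg _ Ux).
  exact: cvg_trans (near_eq_cvg (near_eq _ _ _ fg Ux)) (fC x Ux).
case=> fD fC; split=> [x Ux|v].
  by apply: near_eq_differentiable (near_eq _ _ _ fg Ux) _; exact: fD.
apply: IH (fC v) => x Ux; exact/near_eq_derive/near_eq.
Unshelve. all: by end_near. Qed.

Lemma Ck_pred m (W : normedModType R) k (U : set 'rV[R]_m) (f : 'rV[R]_m -> W) :
  Ck k.+1 U f -> Ck k U f.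
Proof.
elim: k f => [|k IH] f /=.
  by case=> fD _ x Ux; apply: differentiable_continuous; exact: fD.
by case=> fD fC; split=> // v; exact/IH/fC.
Qed.

Lemma Ck_cst m (W : normedModType R) k (U : set 'rV[R]_m) (w : W) :
  Ck k U (fun=> w).
Proof.
elim: k w => [|k IH] w /=; first by move=> x _; exact: cst_continuous.
split=> [x _|v]; first exact: differentiable_cst.
suff -> : 'D_v (fun=> w) = (fun=> 0) :> ('rV[R]_m -> W) by exact: IH.
by apply/funext => x; exact: derive_cst.
Qed.

Lemma CkD m (W : normedModType R) k (U : set 'rV[R]_m) (f g : 'rV[R]_m -> W) :
  open U -> Ck k U f -> Ck k U g -> Ck k U (f \+ g).
Proof.
move=> oU; elim: k f g => [|k IH] f g /=.
  by move=> fC gC x Ux; apply: continuousD; [exact: fC|exact: gC].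
case=> fD fC [gD gC]; split=> [x Ux|v].
  by apply: differentiableD; [exact: fD|exact: gD].
apply: (Ck_eq oU _ (IH _ _ (fC v) (gC v))) => x Ux /=.
by rewrite deriveD//; apply: diff_derivable; [exact: fD|exact: gD].
Qed.

Lemma Ck_sum m (W : normedModType R) k (U : set 'rV[R]_m) n
    (f : 'I_n -> 'rV[R]_m -> W) :
  open U -> (forall i, Ck k U (f i)) -> Ck k U (fun x => \sum_i f i x).
Proof.
move=> oU; elim: n f => [|n IH] f fC.
  rewrite (_ : (fun _ => _) = fun=> 0); first exact: Ck_cst.
  by apply/funext => x; rewrite big_ord0.
rewrite (_ : (fun _ => _) =
  (fun x => \sum_(i < n) f (widen_ord (leqnSn n) i) x) \+ f ord_max).
  by apply: CkD => //; exact: IH.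
by apply/funext => x; rewrite big_ord_recr.
Qed.

Lemma scaler_is_bilinear (W : normedModType R) :
  bilinear_for
    (GRing.Scale.Law.clone _ _ *:%R _) (GRing.Scale.Law.clone _ _ *:%R _)
    (@GRing.scale R W : R -> W -> W).
Proof.
split=> [u'|u] a x y /=.
- by rewrite scalerDl -scalerA.
- by rewrite scalerDr !scalerA mulrC.
Qed.
Lemma differentiable_scale (V W : normedModType R) (a : V -> R) (f : V -> W) x :
  differentiable a x -> differentiable f x ->
  differentiable (fun y => a y *: f y) x /\
  forall v, 'D_v (fun y => a y *: f y) x = a x *: 'D_v f x + 'D_v a x *: f x.
Proof.
move=> da df.
pose sM := bilinear_isBilinear.Build R R W W _ _ (@GRing.scale R W)
  (@scaler_is_bilinear W).
pose s : {bilinear R -> W -> W} := HB.pack (@GRing.scale R W) sM.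
have sc : continuous (fun p : R * W => s p.1 p.2).
  by move=> p; exact: scale_continuous.
have dp : differentiable (fun y => (a y, f y)) x by exact: differentiable_pair.
have db : differentiable (fun p : R * W => p.1 *: p.2) (a x, f x).
  exact: (differentiable_bilin (a x, f x) sc).
have dc : differentiable (fun y => a y *: f y) x.
  exact: (differentiable_comp dp db).
split=> // v; rewrite !deriveE//.
rewrite (diff_comp dp db : 'd (fun y => a y *: f y) x = _ :> (V -> W)) /=.
by rewrite diff_pair//= (diff_bilin (a x, f x) sc).
Qed.

Lemma Ck_scale m (W : normedModType R) k (U : set 'rV[R]_m)
    (a : 'rV[R]_m -> R) (f : 'rV[R]_m -> W) :
  open U -> Ck k U a -> Ck k U f -> Ck k U (fun x => a x *: f x).
Proof.
move=> oU; elim: k a f => [|k IH] a f.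
  by move=> aC fC x Ux; apply: continuousZ; [exact: aC|exact: fC].
move=> aC fC; have [[aD aC'] [fD fC']] := (aC, fC).
split=> [x Ux|v].
  by have [] := differentiable_scale (aD x Ux) (fD x Ux).
have aC0 := Ck_pred aC; have fC0 := Ck_pred fC.
apply: (Ck_eq oU _ (CkD oU (IH _ _ aC0 (fC' v)) (IH _ _ (aC' v) fC0))).
by move=> x Ux /=; have [_ ->] := differentiable_scale (aD x Ux) (fD x Ux).
Qed.

Lemma Ck_postlin m (W W' : normedModType R) k (U : set 'rV[R]_m)
    (l : {linear W -> W'}) (f : 'rV[R]_m -> W) :
  continuous l -> open U -> Ck k U f -> Ck k U (l \o f).
Proof.
move=> lc oU; elim: k f => [|k IH] f.
  by move=> fC x Ux; apply: continuous_comp; [exact: fC|exact: lc].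
case=> fD fC; split=> [x Ux|v].
  by apply: differentiable_comp; [exact: fD|exact: linear_differentiable].
apply: (Ck_eq oU _ (IH _ (fC v))) => x Ux /=.
have dl y : differentiable l y by exact: linear_differentiable.
have df := fD x Ux.
rewrite (deriveE v df) deriveE; last exact: differentiable_comp.
by rewrite (diff_comp df (dl _)) /= diff_lin.
Qed.

Lemma rV_linear_continuous m (W : normedModType R)
  (l : {linear 'rV[R]_m -> W}) : continuous l.
Proof.
rewrite (_ : (l : _ -> _) =
  fun x => \sum_i x 0 i *: l (delta_mx 0 i)); last first.
  apply/funext => x; rewrite [in LHS](row_sum_delta x) linear_sum.
  by apply: eq_bigr => i _; rewrite linearZ.
suff C0 : Ck 0 setT (fun x : 'rV[R]_m => \sum_i x 0 i *: l (delta_mx 0 i)).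
  by move=> x; exact: C0.
apply: Ck_sum; first exact: openT.
move=> i x _; apply: continuousZ; last exact: cst_continuous.
exact: coord_continuous.
Qed.

Lemma Ck_lin m (W : normedModType R) k (U : set 'rV[R]_m)
  (l : {linear 'rV[R]_m -> W}) : Ck k U l.
Proof.
have lc := @rV_linear_continuous m W l.
case: k => [|k] /=; first by move=> x _; exact: lc.
split=> [x _|v]; first exact: linear_differentiable.
rewrite (_ : 'D_v l = fun=> l v); first exact: Ck_cst.
apply/funext => x; rewrite deriveE ?diff_lin//; exact: linear_differentiable.
Qed.

Lemma Ck_coord m n k (U : set 'rV[R]_m) (h : 'rV[R]_m -> 'rV[R]_n) j :
  open U -> Ck k U h -> Ck k U (fun x => h x 0 j).
Proof.
move=> oU hC.
have cl : linear (fun y : 'rV[R]_n => y 0 j : R) by move=> a u w; rewrite !mxE.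
pose cM := GRing.isLinear.Build _ _ _ _ _ cl.
pose cL : {linear 'rV[R]_n -> R} := HB.pack (fun y : 'rV[R]_n => y 0 j) cM.
exact: (Ck_postlin (@rV_linear_continuous _ _ cL) oU hC).
Qed.

Lemma Ck_comp m n (W : normedModType R) k (U : set 'rV[R]_n)
    (U' : set 'rV[R]_m) (f : 'rV[R]_n -> W) (h : 'rV[R]_m -> 'rV[R]_n) :
  open U' -> (forall x, U' x -> U (h x)) ->
  Ck k U f -> Ck k U' h -> Ck k U' (f \o h).
Proof.
move=> oU' hU; elim: k f => [|k IH] f.
  by move=> fC hC x Ux; apply: continuous_comp; [exact: hC|exact/fC/hU].
case=> fD fC hC; have [hD hC'] := hC.
split=> [x Ux|v]; first by apply: differentiable_comp; [exact: hD|exact/fD/hU].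
have hCk := Ck_pred hC.
have C j : Ck k U' (fun x => 'D_v h x 0 j *: 'D_(delta_mx 0 j) f (h x)).
  by apply: Ck_scale => //; [exact/Ck_coord/hC'|exact: (IH _ (fC _) hCk)].
apply: (Ck_eq oU' _ (Ck_sum oU' C)) => x Ux /=.
have dh := hD x Ux; have df := fD _ (hU x Ux).
rewrite [RHS]deriveE; last exact: differentiable_comp.
rewrite (diff_comp dh df) /= -(deriveE v dh) [in RHS](row_sum_delta ('D_v h x)).
rewrite linear_sum; apply: eq_bigr => j _.
by rewrite linearZ /= (deriveE _ df).
Qed.

Lemma Ck_bigcup m (W : normedModType R) k I (O : I -> set 'rV[R]_m)
    (f : 'rV[R]_m -> W) :
  (forall i, Ck k (O i) f) -> Ck k (\bigcup_i O i) f.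
Proof.
elim: k f => [|k IH] f fC; first by move=> x [i _ Ox]; exact: (fC i).
split=> [x [i _ Ox]|v]; first exact: (fC i).1.
by apply: IH => i; exact: (fC i).2.
Qed.

Lemma Ck_row_mx l m n k (U : set 'rV[R]_l) (f : 'rV[R]_l -> 'rV[R]_m)
    (g : 'rV[R]_l -> 'rV[R]_n) :
  open U -> Ck k U f -> Ck k U g -> Ck k U (fun x => row_mx (f x) (g x)).
Proof.
move=> oU fC gC.
pose lf : {linear 'rV[R]_m -> 'rV[R]_(m + n)} := mulmxr (row_mx 1%:M 0).
pose lg : {linear 'rV[R]_n -> 'rV[R]_(m + n)} := mulmxr (row_mx 0 1%:M).
have Cf := Ck_postlin (@rV_linear_continuous _ _ lf) oU fC.
have Cg := Ck_postlin (@rV_linear_continuous _ _ lg) oU gC.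
apply: (Ck_eq oU _ (CkD oU Cf Cg)) => x _ /=.
by rewrite !mul_mx_row !mulmx0 !mulmx1 add_row_mx add0r addr0.
Qed.

End Smooth.

Section Diffeology.
Variable R : realType.

(* A map from an open set [U] of R^m to [X] is represented by a total function
   up to equality on [U]; no total function represents the empty map to an
   empty [X], so this encoding is for inhabited sets [X]. *)
Record diffeology (X : Type) := Diffeology {
  plot : forall m : nat, set 'rV[R]_m -> ('rV[R]_m -> X) -> Prop;
  plot_open : forall m (U : set 'rV[R]_m) (p : 'rV[R]_m -> X),
    plot U p -> open U;
  plot_eq : forall m (U : set 'rV[R]_m) (p q : 'rV[R]_m -> X),
    (forall u, U u -> p u = q u) -> plot U p -> plot U q;
  plot_cst : forall m (U : set 'rV[R]_m) (x : X),
    open U -> plot U (fun=> x);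
  plot_comp : forall m n (U : set 'rV[R]_m) (U' : set 'rV[R]_n)
      (p : 'rV[R]_m -> X) (h : 'rV[R]_n -> 'rV[R]_m),
    plot U p -> open U' -> smooth_on U' h -> (forall u, U' u -> U (h u)) ->
    plot U' (p \o h);
  plot_bigcup : forall m (I : Type) (O : I -> set 'rV[R]_m)
      (p : 'rV[R]_m -> X),
    (forall i, plot (O i) p) -> plot (\bigcup_i O i) p
}.

Definition dsmooth (X Y : Type) (DX : diffeology X) (DY : diffeology Y)
    (f : X -> Y) : Prop :=
  forall m (U : set 'rV[R]_m) (p : 'rV[R]_m -> X),
    plot DX U p -> plot DY U (f \o p).

Definition std_plot (W : normedModType R) m (U : set 'rV[R]_m)
  (p : 'rV[R]_m -> W) : Prop := open U /\ smooth_on U p.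

Program Definition std_diffeology (W : normedModType R) : diffeology W :=
  @Diffeology W (@std_plot W) _ _ _ _ _.
Next Obligation. by move=> W m U p []. Qed.
Next Obligation.
by move=> W m U p q pq [oU pC]; split=> // k; exact: (Ck_eq oU pq).
Qed.
Next Obligation. by move=> W m U x oU; split=> // k; exact: Ck_cst. Qed.
Next Obligation.
move=> W m n U U' p h [oU pC] oU' hC hU; split=> // k.
exact: (Ck_comp oU' hU (pC k) (hC k)).
Qed.
Next Obligation.
move=> W m I O p pC; split; first by apply: bigcup_open => i _; case: (pC i).
by move=> k; apply: Ck_bigcup => i; exact: (pC i).2.
Qed.

Definition prod_plot (X Y : Type) (DX : diffeology X) (DY : diffeology Y) m
    (U : set 'rV[R]_m) (p : 'rV[R]_m -> X * Y) : Prop :=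
  plot DX U (fst \o p) /\ plot DY U (snd \o p).

Program Definition prod_diffeology (X Y : Type) (DX : diffeology X)
    (DY : diffeology Y) : diffeology (X * Y) :=
  @Diffeology (X * Y) (@prod_plot X Y DX DY) _ _ _ _ _.
Next Obligation. by move=> X Y DX DY m U p [/plot_open]. Qed.
Next Obligation.
move=> X Y DX DY m U p q pq [p1 p2].
by split; [apply: plot_eq p1|apply: plot_eq p2] => u Uu /=; rewrite pq.
Qed.
Next Obligation.
by move=> X Y DX DY m U x oU; split; exact: plot_cst.
Qed.
Next Obligation.
move=> X Y DX DY m n U U' p h [p1 p2] oU' hC hU.
by split; [exact: plot_comp p1 _ _ _|exact: plot_comp p2 _ _ _].
Qed.
Next Obligation.
by move=> X Y DX DY m I O p pO; split; apply: plot_bigcup => i; case: (pO i).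
Qed.

Definition diffeological_vspace (V : lmodType R) (D : diffeology V) : Prop :=
  dsmooth (prod_diffeology D D) D (fun x => x.1 + x.2) /\
  dsmooth (prod_diffeology (std_diffeology R) D) D (fun x => x.1 *: x.2).

End Diffeology.

Section Dual.
Variables (R : realType) (V : vectType R) (D : diffeology R V).

Definition smooth_functional (f : 'Hom(V, R^o)) : Prop :=
  dsmooth D (std_diffeology R) f.

Lemma vspace_of_pred (W : vectType R) (P : W -> Prop) :
  P 0 -> (forall a u v, P u -> P v -> P (a *: u + v)) ->
  exists U : {vspace W}, forall v, v \in U <-> P v.
Proof.
move=> P0 PL.
pose Q d := `[< exists2 U : {vspace W}, \dim U = d & forall v, v \in U -> P v >].
have Q0 : exists d, Q d.
  exists 0%N; apply/asboolP; exists 0%VS; first exact: dimv0.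
  by move=> v; rewrite memv0 => /eqP ->.
have Qb d : Q d -> (d <= \dim {:W})%N.
  by move=> /asboolP[U <- _]; exact/dimvS/subvf.
case: (ex_maxnP Q0 Qb) => d /asboolP[U Ud UP] dmax.
exists U => v; split=> [|Pv]; first exact: UP.
have QUv : Q (\dim (<[v]> + U)%VS).
  apply/asboolP; exists (<[v]> + U)%VS => // w.
  move=> /memv_addP[_ /vlineP[a ->] [u uU ->]].
  exact/PL/UP.
have := dmax _ QUv; rewrite -Ud.
have UvU := addvSr <[v]> U.
rewrite (geq_leqif (dimv_leqif_eq UvU)) => /eqP ->.
by rewrite (subvP (addvSl _ _))// memv_line.
Qed.

Lemma smooth_functional0 : smooth_functional 0.
Proof.
move=> m U p /plot_open oU.
by apply: plot_eq (plot_cst (std_diffeology R) 0 oU) => u _ /=; rewrite lfunE.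
Qed.

Lemma smooth_functionalP a f g : smooth_functional f -> smooth_functional g ->
  smooth_functional (a *: f + g).
Proof.
move=> fC gC m U p Up; have [oU fpC] := fC _ _ _ Up; have [_ gpC] := gC _ _ _ Up.
split=> // k; have aC : Ck k U (fun=> a : R) by exact: Ck_cst.
apply: (Ck_eq oU _ (CkD oU (Ck_scale oU aC (fpC k)) (gpC k))) => u _ /=.
by rewrite !lfunE /= lfunE.
Qed.

(* Chosen classically; characterized by [mem_dual_space]. *)
Definition dual_space : {vspace 'Hom(V, R^o)} :=
  projT1 (cid (vspace_of_pred smooth_functional0 smooth_functionalP)).

Lemma mem_dual_space (f : 'Hom(V, R^o)) :
  f \in dual_space <-> smooth_functional f.
Proof. by rewrite /dual_space; case: cid => U /= ->. Qed.

Definition dual : vectType R := subvs_of dual_space.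

Definition dual_fun (f : dual) : V -> R := vsval f : 'Hom(V, R^o).

(* An open subset of R^m times an open subset of R^n is an open subset of
   R^(m + n). *)
Definition functional_plot m (U : set 'rV[R]_m) (q : 'rV[R]_m -> dual) : Prop :=
  open U /\
  forall n (U' : set 'rV[R]_n) (p : 'rV[R]_n -> V), plot D U' p ->
    smooth_on [set z : 'rV[R]_(m + n) | U (lsubmx z) /\ U' (rsubmx z)]
      (fun z => dual_fun (q (lsubmx z)) (p (rsubmx z))).

Lemma open_setM m n (U : set 'rV[R]_m) (U' : set 'rV[R]_n) :
  open U -> open U' ->
  open [set z : 'rV[R]_(m + n) | U (lsubmx z) /\ U' (rsubmx z)].
Proof.
move=> oU oU'; apply: openI.
  by apply: (open_comp _ oU) => z _; exact: continuous_lsubmx.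
by apply: (open_comp _ oU') => z _; exact: continuous_rsubmx.
Qed.

Lemma dual_fun_smooth (f : dual) n (U' : set 'rV[R]_n) p :
  plot D U' p -> smooth_on U' (fun u => dual_fun f (p u)).
Proof.
move=> Up; have /mem_dual_space fC := subvsP f.
by have [] := fC _ _ _ Up.
Qed.

Program Definition functional_diffeology : diffeology R dual :=
  @Diffeology R dual functional_plot _ _ _ _ _.
Next Obligation. by move=> m U p []. Qed.
Next Obligation.
move=> m U q q' qq' [oU qC]; split=> // n U' p Up k.
apply: (Ck_eq _ _ (qC _ _ _ Up k)).
  exact: open_setM oU (plot_open Up).
by move=> z [Uz _]; rewrite qq'.
Qed.
Next Obligation.
move=> m U f oU; split=> // n U' p Up k.
apply: (@Ck_comp _ _ _ _ _ U' _ (fun u => dual_fun f (p u)) rsubmx).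
- exact: open_setM oU (plot_open Up).
- by move=> z [].
- exact: dual_fun_smooth.
- exact: Ck_lin.
Qed.
Next Obligation.
move=> m m' U O q h [oU qC] oO hC hU; split=> // n U' p Up k.
have oOU' := open_setM oO (plot_open Up).
pose H (z : 'rV[R]_(m' + n)) := row_mx (h (lsubmx z)) (rsubmx z).
apply: (Ck_eq oOU' _ (Ck_comp oOU' _ (qC _ _ _ Up k) (h := H) _)).
- by move=> z _; rewrite /= /H row_mxKl row_mxKr.
- by move=> z [Oz U'z] /=; rewrite /H row_mxKl row_mxKr; split=> //; exact: hU.
- apply: Ck_row_mx => //; last exact: Ck_lin.
  apply: (Ck_comp oOU' _ (hC k)); last exact: Ck_lin.
  by move=> z [].
Qed.
Next Obligation.
move=> m I O q qO; split; first by apply: bigcup_open => i _; case: (qO i).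
move=> n U' p Up k.
rewrite (_ : [set z | _] = \bigcup_i
    [set z : 'rV[R]_(m + n) | O i (lsubmx z) /\ U' (rsubmx z)]).
  by apply: Ck_bigcup => i; exact: (qO i).2.
apply/seteqP; split=> [z [[i _ Oz] U'z]|z [i _ [Oz U'z]]].
  by exists i.
by split=> //; exists i.
Qed.

Lemma dual_diffeological_vspace : diffeological_vspace functional_diffeology.
Proof.
split=> m U q [qC1 qC2]; have oU := plot_open qC1; split=> // n U' p Up k.
  have oUU' := open_setM oU (plot_open Up).
  apply: (Ck_eq oUU' _ (CkD oUU' (qC1.2 _ _ _ Up k) (qC2.2 _ _ _ Up k))).
  by move=> z _; rewrite /= /dual_fun linearD /= lfunE.
have oUU' := open_setM oU (plot_open Up).
have C1 : Ck k [set z : 'rV[R]_(m + n) | U (lsubmx z) /\ U' (rsubmx z)]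
    (fun z => (q (lsubmx z)).1).
  apply: (Ck_comp oUU' _ (qC1.2 k)); last exact: Ck_lin.
  by move=> z [].
apply: (Ck_eq oUU' _ (Ck_scale oUU' C1 (qC2.2 _ _ _ Up k))).
by move=> z _; rewrite /= /dual_fun linearZ /= lfunE.
Qed.

End Dual.

Section PseudoMetric.
Variables (R : realType) (V : vectType R) (D : diffeology R V).

(* The identification of [V] with R^n given by the basis [e]. *)
Definition coordv n (e : n.-tuple V) (v : V) : 'cV[R]_n :=
  \col_i coord e i v.

Definition mxform n (e : n.-tuple V) (A : 'M[R]_n) (v w : V) : R :=
  ((coordv e v)^T *m A *m coordv e w) 0 0.

Record pseudo_metric n (e : n.-tuple V) (A : 'M[R]_n) : Prop := PseudoMetric {
  pm_sym : A^T = A;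
  pm_smooth : dsmooth (prod_diffeology D D) (std_diffeology R)
    (fun vw => mxform e A vw.1 vw.2);
  pm_mult0 : mup 0 (char_poly A) = (n - \dim (dual_space D))%N;
  pm_pos : forall a : R, eigenvalue A a -> a != 0 -> 0 < a
}.

Lemma mxform_linear n (e : n.-tuple V) (A : 'M[R]_n) (v : V) :
  linear (fun w => mxform e A w v : R^o).
Proof.
move=> a u w; rewrite /mxform.
have -> : coordv e (a *: u + w) = a *: coordv e u + coordv e w.
  by apply/colP => i; rewrite !mxE linearP.
by rewrite linearP /= !mulmxDl -!scalemxAl !mxE.
Qed.

Definition pairing_functional n (e : n.-tuple V) (A : 'M[R]_n) (v : V) :
    'Hom(V, R^o) := linfun (fun w => mxform e A w v : R^o).

Lemma pairing_functionalE n (e : n.-tuple V) (A : 'M[R]_n) (v w : V) :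
  pairing_functional e A v w = mxform e A w v.
Proof.
pose lM := GRing.isLinear.Build _ _ _ _ _ (mxform_linear e A v).
pose l : {linear V -> R^o} := HB.pack (fun w => mxform e A w v : R^o) lM.
exact: (lfunE l w).
Qed.

Lemma pairing_dual_space n (e : n.-tuple V) (A : 'M[R]_n) (v : V) :
  pseudo_metric e A -> pairing_functional e A v \in dual_space D.
Proof.
move=> hA; apply/mem_dual_space => m U p Up.
have Upv : plot (prod_diffeology D D) U (fun u => (p u, v)).
  by split=> //=; exact/plot_cst/plot_open/Up.
apply: plot_eq (pm_smooth hA Upv) => u _ /=.
by rewrite pairing_functionalE.
Qed.

Definition Psi n (e : n.-tuple V) (A : 'M[R]_n) (hA : pseudo_metric e A)
  (v : V) : dual D := Subvs (pairing_dual_space v hA).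

End PseudoMetric.

Record smooth_scalar_product (R : realType) (W : lmodType R)
    (D : diffeology R W) (g : W -> W -> R) : Prop := SmoothScalarProduct {
  ssp_linearl : forall y, scalar (g^~ y);
  ssp_linearr : forall x, scalar (g x);
  ssp_sym : forall x y, g x y = g y x;
  ssp_posdef : forall x, x != 0 -> 0 < g x x;
  ssp_smooth : dsmooth (prod_diffeology D D) (std_diffeology R)
    (fun xy => g xy.1 xy.2)
}.

(* Main.v *)
(* Geometric multiplicity is at most algebraic multiplicity, so the condition
   on the eigenvalue 0 gives rank A >= dim V*. In coordinates (values on the
   basis e), the functionals Psi v form the row space of A, which sits inside
   the space of smooth functionals; comparing dimensions, the two coincide and
   Psi is onto. Minimizing the Rayleigh quotient shows that A is positive
   semidefinite, so <v|v> = 0 forces A v = 0, i.e. Psi v = 0. Finally, with B a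
   generalized inverse of A (A B A = A), the induced form is
   <f, g> = f(e) B g(e)^T, which is smooth because each evaluation f |-> f(e_i)
   is smooth for the functional diffeology. *)
Require Import Defs.
From HB Require Import structures.
From mathcomp Require Import all_boot all_order all_algebra.
From mathcomp Require Import all_classical all_reals all_analysis.
From mathcomp Require Import ring.
Import Order.TTheory GRing.Theory Num.Theory.
Import numFieldNormedType.Exports.
Local Open Scope classical_set_scope.
Local Open Scope ring_scope.

(** * Rank and the algebraic multiplicity of the eigenvalue 0 *)

Lemma leq_corank_mup0 (F : fieldType) n (A : 'M[F]_n) :
  (n - \rank A <= mup 0 (char_poly A))%N.
Proof.
rewrite mup_geq ?monic_neq0 ?char_poly_monic// subr0.
(* The last n - rank A rows of P A vanish, so those of P ('X - A) are divisible
   by 'X. *)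
set P := invmx (col_ebase A).
have PU : \det P != 0.
  by rewrite -unitfE -unitmxE unitmx_inv col_ebase_unit.
have PA0 (i j : 'I_n) : (\rank A <= i)%N -> (P *m A) i j = 0.
  move=> ri; rewrite -[A]mulmx_ebase -mulmxA mulKmx ?col_ebase_unit// mxE.
  by rewrite big1// => k _; rewrite mxE ltnNge ri andbF mul0r.
pose d : 'rV[{poly F}]_n := \row_i (if (i < \rank A)%N then 1 else 'X).
pose N := \matrix_(i, j) (if (i < \rank A)%N
  then (map_mx polyC P *m char_poly_mx A) i j else (P i j)%:P).
have dN : map_mx polyC P *m char_poly_mx A = diag_mx d *m N.
  apply/matrixP => i j; rewrite mul_diag_mx [RHS]mxE [d _ _]mxE [N _ _]mxE.
  case: ltnP => ri; first by rewrite mul1r.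
  rewrite /char_poly_mx mulmxBr -map_mxM mul_mx_scalar !mxE.
  have := PA0 i j ri; rewrite mxE => ->.
  by rewrite subr0.
have := congr1 determinant dN; rewrite !det_mulmx det_map_mx det_diag => dE.
(* [\det P] is a nonzero constant, so a power of 'X dividing the determinant of P ('X - A) divides
   the characteristic polynomial. *)
rewrite -(dvdpZr _ _ PU) -mul_polyC [X in _ %| X]dE.
apply: dvdp_mulr.
rewrite (eq_bigr (fun i : 'I_n =>
  if (i < \rank A)%N then 1 else 'X)); last first.
  by move=> i _; rewrite mxE.
rewrite -(big_mkord xpredT (fun i => if (i < \rank A)%N then 1 else 'X)).
rewrite (big_cat_nat (leq0n _) (rank_leq_row A))//= [X in _ * X]big_nat_cond.
apply: dvdp_mull; rewrite (eq_bigr (fun=> 'X)); last first.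
  by move=> i /andP[/andP[ri _] _]; rewrite ltnNge ri.
by rewrite -big_nat_cond prodr_const_nat.
Qed.

(** * Isotropic vectors of semidefinite forms *)

Lemma sqnorm_ge0 (F : realDomainType) n (x : 'rV[F]_n) : 0 <= (x *m x^T) 0 0.
Proof. by rewrite mxE sumr_ge0// => i _; rewrite mxE -expr2 sqr_ge0. Qed.

Lemma sqnorm_eq0 (F : realDomainType) n (x : 'rV[F]_n) :
  (x *m x^T) 0 0 = 0 -> x = 0.
Proof.
rewrite mxE => /eqP; rewrite psumr_eq0 => [/allP x0|i _]; last first.
  by rewrite mxE -expr2 sqr_ge0.
apply/rowP => i; have := x0 i (mem_index_enum i).
by rewrite !mxE -expr2 sqrf_eq0 => /eqP.
Qed.

(** The form attains its minimum 0 at x, so its derivative at x in the direction y = x B, which is 2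
    |y|^2, must vanish. *)
Lemma psd_isotropic_ker (F : realFieldType) n (B : 'M[F]_n) (x : 'rV[F]_n) :
  B^T = B -> (forall y : 'rV[F]_n, 0 <= (y *m B *m y^T) 0 0) ->
  (x *m B *m x^T) 0 0 = 0 -> x *m B = 0.
Proof.
move=> BT B0 xB0; set y := x *m B; apply: sqnorm_eq0.
set s := (y *m y^T) 0 0; set q := (y *m B *m y^T) 0 0.
have q0 : 0 <= q by exact: B0.
have E t : ((x + t *: y) *m B *m (x + t *: y)^T) 0 0 = t * s *+ 2 + t ^+ 2 * q.
  have yx : (y *m B *m x^T) 0 0 = s.
    by rewrite /s {2}/y trmx_mul BT mulmxA.
  have entryD (M N : 'M[F]_1) : (M + N) 0 0 = M 0 0 + N 0 0 by rewrite mxE.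
  have entryZ a (M : 'M[F]_1) : (a *: M) 0 0 = a * M 0 0 by rewrite mxE.
  rewrite linearD linearZ /= !mulmxDl !mulmxDr -!scalemxAl -!scalemxAr -/y.
  by rewrite !entryD !entryZ xB0 yx -/s -/q; ring.
(* Any small step against the gradient would do; dividing by q + 1 instead of q also covers q =
   0. *)
have := B0 (x + (- s / (q + 1)) *: y); rewrite E.
have q1 : 0 < q + 1 by rewrite ltr_wpDl.
have -> : - s / (q + 1) * s *+ 2 + (- s / (q + 1)) ^+ 2 * q =
    - (s ^+ 2 * ((q + 2) / (q + 1) ^+ 2)).
  by field; rewrite gt_eqF.
rewrite oppr_ge0 pmulr_lle0; last by rewrite divr_gt0 ?exprn_gt0// ltr_wpDl.
by move=> s0; apply/eqP; rewrite -sqrf_eq0 eq_le s0 sqr_ge0.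
Qed.

(** * Regularity of bilinear forms, and minimization on the unit sphere *)

(** Hypotheses bear on coordinates, the form in which plots of the dual are controlled; k = 0 gives
    the continuity of quadratic forms. *)
Lemma Ck_bilin (R : realType) m k (U : set 'rV[R]_m) n (M : 'M[R]_n)
    (f g : 'rV[R]_m -> 'rV[R]_n) : open U ->
  (forall i, Ck k U (fun x => f x 0 i)) ->
  (forall i, Ck k U (fun x => g x 0 i)) ->
  Ck k U (fun x => (f x *m M *m (g x)^T) 0 0).
Proof.
move=> oU fC gC.
apply: (@Ck_eq _ _ _ _ _
  (fun x => \sum_j \sum_i (f x 0 i *: (M i j *: g x 0 j)))) => //.
  move=> x _; rewrite mxE; apply: eq_bigr => j _; rewrite !mxE mulr_suml.
  by apply: eq_bigr => i _; rewrite -mulrA.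
apply: Ck_sum => // j; apply: Ck_sum => // i; apply: Ck_scale => //.
by apply: Ck_scale => //; exact: Ck_cst.
Qed.

Lemma quad_continuous (R : realType) n (M : 'M[R]_n) :
  continuous (fun x : 'rV[R]_n => (x *m M *m x^T) 0 0).
Proof.
have id_coord i : Ck 0 setT (fun x : 'rV[R]_n => x 0 i).
  by move=> x _; exact: coord_continuous.
by move=> x; apply: (Ck_bilin _ _ 0 _ _ M id id openT id_coord id_coord).
Qed.

Lemma sphere_compact (R : realType) n :
  compact [set x : 'rV[R]_n | (x *m x^T) 0 0 = 1].
Proof.
apply: bounded_closed_compact.
  exists 1; split=> // M M1 x /= x1; apply: ltW; apply: le_lt_trans M1.
  (* The norm on row vectors is the max norm, attained at an entry whose square is at most the sum
     of squares. *)
  have [->|] := eqVneq `|x| 0; first exact: ler01.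
  move=> /mx_norm_neq0[[i j]] /=; rewrite [i]ord1 => xj.
  rewrite [`|x|]xj.
  rewrite -(@expr_le1 _ 2)// real_normK ?num_real// -x1 mxE (bigD1 j)//=.
  rewrite mxE -expr2 lerDl sumr_ge0// => k _.
  by rewrite mxE -expr2 sqr_ge0.
have -> : [set x : 'rV[R]_n | (x *m x^T) 0 0 = 1] =
    (fun x => (x *m 1%:M *m x^T) 0 0) @^-1` [set 1].
  by apply/seteqP; split=> x /=; rewrite mulmx1.
apply: closed_comp; first by move=> x _; exact: quad_continuous.
exact: closed_eq.
Qed.

(** If c minimizes the form q on the unit sphere, then A - q(c) is semidefinite with c isotropic, so
    c A = q(c) c: the minimum is itself an eigenvalue. *)
Lemma eigenvalue_ge0_psd (R : realType) n (A : 'M[R]_n) (x : 'rV[R]_n) :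
  A^T = A -> (forall a : R, eigenvalue A a -> 0 <= a) ->
  0 <= (x *m A *m x^T) 0 0.
Proof.
move=> AT A0; have [->|x0] := eqVneq x 0; first by rewrite !mul0mx mxE.
pose q (y : 'rV[R]_n) : R := (y *m A *m y^T) 0 0.
pose S : set 'rV[R]_n := [set y | (y *m y^T) 0 0 = 1].
pose u (y : 'rV[R]_n) := (Num.sqrt ((y *m y^T) 0 0))^-1 *: y.
have scal (M : 'M[R]_n) a (y : 'rV[R]_n) :
    ((a *: y) *m M *m (a *: y)^T) 0 0 = a ^+ 2 * (y *m M *m y^T) 0 0.
  by rewrite linearZ /= -!scalemxAl -scalemxAr scalerA !mxE expr2.
have sq_gt0 (y : 'rV[R]_n) : y != 0 -> 0 < (y *m y^T) 0 0.
  move=> y0; rewrite lt0r; apply/andP; split; last exact: sqnorm_ge0.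
  by apply: contra_neq y0; exact: sqnorm_eq0.
have uS (y : 'rV[R]_n) : y != 0 -> S (u y).
  move=> y0; have := scal 1%:M (Num.sqrt ((y *m y^T) 0 0))^-1 y.
  rewrite !mulmx1 /S /= => ->.
  by rewrite exprVn sqr_sqrtr ?mulVf ?gt_eqF ?sq_gt0//; exact: sqnorm_ge0.
have [c /set_mem cS cmin] : exists2 c, c \in S & forall y, y \in S -> q c <= q y.
  apply: EVT_min_rV; [by exists (u x); exact: uS|exact: sphere_compact|].
  exact/continuous_subspaceT/quad_continuous.
pose B := A - (q c)%:M.
have BE (y : 'rV[R]_n) : (y *m B *m y^T) 0 0 = q y - q c * (y *m y^T) 0 0.
  rewrite /B mulmxBr mulmxBl mul_mx_scalar -scalemxAl.
  by rewrite mxE [X in _ + X]mxE [X in - X]mxE.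
have B0 (y : 'rV[R]_n) : 0 <= (y *m B *m y^T) 0 0.
  have [->|y0] := eqVneq y 0; first by rewrite !mul0mx mxE.
  have := cmin (u y) (mem_set (uS y y0)); rewrite BE subr_ge0.
  rewrite {2}/q /u scal exprVn sqr_sqrtr 1?mulrC; last exact: sqnorm_ge0.
  by rewrite ler_pdivlMr ?sq_gt0.
have cB : c *m B = 0.
  apply: psd_isotropic_ker B0 _; first by rewrite /B linearB /= AT tr_scalar_mx.
  by rewrite BE cS mulr1 subrr.
have qc0 : 0 <= q c.
  apply: A0; apply/eigenvalueP; exists c.
    by move/eqP: cB; rewrite /B mulmxBr mul_mx_scalar subr_eq0 => /eqP.
  apply/eqP => c0; move: cS; rewrite /S /= c0 mul0mx mxE => /eqP.
  by rewrite eq_sym oner_eq0.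
rewrite -/(q x) (le_trans _ (_ : q c * (x *m x^T) 0 0 <= _))//.
  by rewrite mulr_ge0//; exact: sqnorm_ge0.
by rewrite -subr_ge0 -BE.
Qed.

(** * Coordinates on the dual *)

Section DualMetric.
Variables (R : realType) (V : vectType R) (D : diffeology R V).
Variables (n : nat) (e : n.-tuple V).

Definition dual_coord (f : dual D) : 'rV[R]_n := \row_i dual_fun f e`_i.

Lemma dual_coord_linear : linear dual_coord.
Proof.
move=> a f g; apply/rowP => i; rewrite !mxE /dual_fun linearP /=.
by rewrite lfunE /= lfunE.
Qed.

HB.instance Definition _ :=
  GRing.isLinear.Build R (dual D) 'rV[R]_n *:%R dual_coord dual_coord_linear.

Lemma dual_coord_smooth m (U : set 'rV[R]_m) (q : 'rV[R]_m -> dual D) k i :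
  functional_plot U q -> Ck k U (fun u => dual_coord (q u) 0 i).
Proof.
move=> [oU qC].
(* Evaluation at e_i is pairing with a constant plot on the one-point space R^0; [H] identifies R^m
   with R^(m + 0). *)
have cp : plot D [set: 'rV[R]_0] (fun=> e`_i) by apply: plot_cst; exact: openT.
pose H (u : 'rV[R]_m) : 'rV[R]_(m + 0) := row_mx u 0.
apply: (Ck_eq oU _ (Ck_comp (h := H) oU _ (qC _ _ _ cp k) _)).
- by move=> u _ /=; rewrite mxE /H row_mxKl.
- by move=> u Uu /=; rewrite /H row_mxKl.
- apply: Ck_row_mx => //; last exact: Ck_cst.
  exact: (Ck_lin _ _ (idfun : {linear 'rV[R]_m -> 'rV[R]_m})).
Qed.

Hypothesis he : basis_of fullv e.

Lemma dual_coord_inj : injective dual_coord.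
Proof.
move=> f g fg; apply/val_inj/lfunP => v.
rewrite (coord_basis he (memvf v)) !linear_sum; apply: eq_bigr => i _.
rewrite !linearZ; congr (_ *: _).
by have /rowP/(_ i) := fg; rewrite !mxE.
Qed.

Lemma coordv_basis (i : 'I_n) : coordv e e`_i = delta_mx i 0.
Proof.
apply/colP => j; rewrite !mxE coord_free ?(basis_free he)//.
by rewrite eqxx andbT eq_sym.
Qed.

Lemma coordv_surj (x : 'cV[R]_n) : exists v, coordv e v = x.
Proof.
exists (\sum_i x i 0 *: e`_i); apply/colP => i.
by rewrite mxE coord_sum_free ?(basis_free he).
Qed.

(** * Surjectivity and kernel of the pairing *)

Variable A : 'M[R]_n.
Hypothesis hA : pseudo_metric D e A.

Lemma dual_coord_Psi v : dual_coord (Psi hA v) = (coordv e v)^T *m A.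
Proof.
apply: trmx_inj; rewrite trmx_mul trmxK (pm_sym hA); apply/colP => i.
rewrite !mxE /dual_fun /= pairing_functionalE /mxform coordv_basis.
by rewrite trmx_delta -rowE -row_mul !mxE.
Qed.

Lemma dual_coord_sub f : (dual_coord f <= A)%MS.
Proof.
pose F := \matrix_(k < \dim {:dual D}) dual_coord (vbasis {:dual D})`_k.
have FE x : exists y, dual_coord x = y *m F.
  exists (\row_k coord (vbasis {:dual D}) k x).
  rewrite mulmx_sum_row [in LHS](coord_vbasis (memvf x)) linear_sum.
  by apply: eq_bigr => k _; rewrite linearZ mxE rowK.
have AF : (A <= F)%MS.
  apply/row_subP => i; have [v vi] := coordv_surj (delta_mx i 0).
  have [y yE] := FE (Psi hA v).
  by apply/submxP; exists y; rewrite -yE dual_coord_Psi vi trmx_delta -rowE.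
have dimD : \dim {:dual D} = \dim (dual_space D).
  by rewrite dimvf.
(* Subtraction on naturals truncates, so cancelling n in n - rank A <= n - dim V* requires this
   bound. *)
have nA : (\dim (dual_space D) <= n)%N.
  have := dimvS (subvf (dual_space D)).
  by rewrite [X in (_ <= X)%N]dimvf /dim /= muln1 -dimvf (size_basis he).
have rA : (\dim {:dual D} <= \rank A)%N.
  have := leq_corank_mup0 _ _ A; rewrite (pm_mult0 hA) dimD.
  by rewrite leq_sub2lE.
have FA : (F <= A)%MS.
  rewrite -(geq_leqif (mxrank_leqif_sup AF)).
  exact: leq_trans (rank_leq_row _) rA.
by have [y ->] := FE f; apply: submx_trans FA; exact: submxMl.
Qed.

Lemma Psi_surj f : exists v, Psi hA v = f.
Proof.
have /submxP[x xE] := dual_coord_sub f; have [v vx] := coordv_surj x^T.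
by exists v; apply: dual_coord_inj; rewrite dual_coord_Psi vx trmxK xE.
Qed.

Lemma mxform_psd v : 0 <= mxform e A v v.
Proof.
have := eigenvalue_ge0_psd _ _ A (coordv e v)^T (pm_sym hA); rewrite trmxK.
apply=> a; have [->//|a0 aA] := eqVneq a 0; exact/ltW/(pm_pos hA).
Qed.

Lemma mxform_null v : mxform e A v v = 0 -> Psi hA v = 0.
Proof.
move=> v0; apply: dual_coord_inj; rewrite dual_coord_Psi linear0.
apply: (psd_isotropic_ker _ _ _ _ (pm_sym hA)); last by rewrite trmxK.
move=> y; have [w wy] := coordv_surj y^T.
by have := mxform_psd w; rewrite /mxform wy trmxK.
Qed.

(** * The induced metric *)

(** A closed formula instead of a choice of preimages: bilinearity and smoothness are read off
    directly, and [dual_metric_Psi] gives independence of preimages. *)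
Definition dual_metric (f g : dual D) : R :=
  (dual_coord f *m pinvmx A *m (dual_coord g)^T) 0 0.

Lemma dual_metric_Psi v w : dual_metric (Psi hA v) (Psi hA w) = mxform e A v w.
Proof.
rewrite /dual_metric !dual_coord_Psi trmx_mul trmxK (pm_sym hA) mulmxA.
by rewrite -[in LHS](mulmxA _ (pinvmx A)) -(mulmxA _ A) (mulmxA A) mulmxKpV.
Qed.

Lemma dual_metric_ssp :
  smooth_scalar_product (functional_diffeology D) dual_metric.
Proof.
split.
- move=> g a f1 f2; rewrite /dual_metric linearP /= !mulmxDl -!scalemxAl.
  by rewrite mxE [X in X + _]mxE.
- move=> f a g1 g2; rewrite /dual_metric !linearP /=.
  by rewrite mxE [X in X + _]mxE.
(* A generalized inverse of a symmetric matrix need not be symmetric, so symmetry is carried over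
   from A through preimages. *)
- move=> f g; have [v <-] := Psi_surj f; have [w <-] := Psi_surj g.
  rewrite !dual_metric_Psi /mxform.
  rewrite -[in LHS](trmxK (_ *m _ *m _)) mxE !trmx_mul trmxK (pm_sym hA).
  by rewrite mulmxA.
- move=> f f0; have [v vf] := Psi_surj f.
  rewrite -vf dual_metric_Psi lt0r mxform_psd andbT.
  by apply: contra_neq f0 => /mxform_null <-.
- move=> m U p [p1 p2]; have oU := plot_open p1; split=> // k.
  by apply: Ck_bilin => // i; exact: dual_coord_smooth.
Qed.

End DualMetric.

Theorem corollary2p13 (R : realType) (V : vectType R) (D : diffeology R V)
    (hV : diffeological_vspace D) (n : nat) (e : n.-tuple V)
    (he : basis_of fullv e) (A : 'M[R]_n) (hA : pseudo_metric D e A) :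
  (forall f : dual D, exists v : V, Psi hA v = f) /\
  exists g : dual D -> dual D -> R,
    (forall (f1 f2 : dual D) (v w : V), Psi hA v = f1 -> Psi hA w = f2 ->
       g f1 f2 = mxform e A v w) /\
    smooth_scalar_product (functional_diffeology D) g.
Proof.
split; first exact: Psi_surj.
exists (dual_metric R V D n e A); split; last exact: dual_metric_ssp.
by move=> f1 f2 v w <- <-; exact: dual_metric_Psi.
Qed.
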